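(* Let $G$ be a finite simple graph and $r\ge1$ an integer. Then at least one of the following holds: (1) $\chi_r(G)-M_r(G)\le\frac{\omega(G)+\Delta(G)+1}{2}$; (2) $\chi_r(G)-M_r(G)\le\frac{\frac{\omega(G)}{2}+|G|-rM_r(G)}{2}$.
   Context: An $r$-bounded coloring of $G$ is a proper coloring in which every color class has at most $r$ vertices. $\chi_r(G)$ is the minimum number of color classes in an $r$-bounded coloring of $G$ (such a coloring is an optimal $r$-bounded coloring). $M_r(G)$ is the maximum, over all optimal $r$-bounded colorings, of the number of color classes of size exactly $r$. $\omega(G)$, $\Delta(G)$, $|G|$ are the clique number, maximum degree and number of vertices. *)

(* Defs.v *)
From mathcomp Require Import all_boot.

Set Implicit Arguments.
Unset Strict Implicit.
Unset Printing Implicit Defensive.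

(* A finite simple graph is a symmetric irreflexive relation [e] on a
   finType [T] of vertices. *)
Section Graph.

Variables (T : finType) (e : rel T).

Definition clique (K : {set T}) : bool :=
  [forall u in K, forall v in K, (u != v) ==> e u v].

Definition clique_number : nat := \max_(K : {set T} | clique K) #|K|.

Definition max_degree : nat := \max_(v : T) #|[set u | e v u]|.

Definition proper_coloring (C : eqType) (c : T -> C) : bool :=
  [forall u, forall v, e u v ==> (c u != c v)].

(* Unused colors contribute no class: every class is nonempty. *)
Definition color_classes (C : eqType) (c : T -> C) : {set {set T}} :=
  [set [set u | c u == c v] | v : T].

Definition bounded_coloring (r : nat) (C : eqType) (c : T -> C) : bool :=
  proper_coloring c && [forall A in color_classes c, #|A| <= r].

(* The number of classes is minimized over colorings with [T] itself as the
   set of colors, which is no restriction: see [bounded_chi_le] below.  The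
   default value [#|T|] is the number of classes of the identity coloring,
   which is r-bounded as soon as r >= 1. *)
Definition bounded_chi (r : nat) : nat :=
  \big[minn/#|T|]_(c : {ffun T -> T} | bounded_coloring r c)
    #|color_classes c|.

Definition optimal_coloring (r : nat) (C : eqType) (c : T -> C) : bool :=
  bounded_coloring r c && (#|color_classes c| == bounded_chi r).

Definition full_classes (r : nat) (C : eqType) (c : T -> C) : {set {set T}} :=
  [set A in color_classes c | #|A| == r].

Definition max_full_classes (r : nat) : nat :=
  \max_(c : {ffun T -> T} | optimal_coloring r c) #|full_classes r c|.

Lemma recolor (C : eqType) (c : T -> C) :
  exists c' : {ffun T -> T}, forall u v, (c' u == c' v) = (c u == c v).
Proof.
exists [ffun v => odflt v [pick u | c u == c v]] => u v; rewrite !ffunE.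
have pickE w : c (odflt w [pick x | c x == c w]) = c w.
  by case: pickP => [x /eqP|].
apply/eqP/eqP => [eq_uv|eq_uv]; first by rewrite -(pickE u) eq_uv pickE.
rewrite eq_uv; case: pickP => //= /(_ v); by rewrite eqxx.
Qed.

Lemma same_classes (C C' : eqType) (c : T -> C) (c' : T -> C') :
    (forall u v, (c' u == c' v) = (c u == c v)) ->
  color_classes c' = color_classes c.
Proof. by move=> E; apply: eq_imset => v; apply/setP=> u; rewrite !inE E. Qed.

Lemma same_bounded (r : nat) (C C' : eqType) (c : T -> C) (c' : T -> C') :
    (forall u v, (c' u == c' v) = (c u == c v)) ->
  bounded_coloring r c' = bounded_coloring r c.
Proof.
move=> E; rewrite /bounded_coloring (same_classes E); congr (_ && _).
by apply: eq_forallb => u; apply: eq_forallb => v; rewrite E.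
Qed.

Lemma bounded_chi_le (r : nat) (C : eqType) (c : T -> C) :
  bounded_coloring r c -> bounded_chi r <= #|color_classes c|.
Proof.
have [c' E] := recolor c; rewrite -(same_bounded r E) -(same_classes E).
move=> bc'; rewrite /bounded_chi; have := mem_index_enum c'.
elim: (index_enum _) => // d s IHs; rewrite inE big_cons => /predU1P[<-|s_c'].
  by rewrite bc' geq_minl.
by case: ifP => _; rewrite ?geq_min IHs ?orbT.
Qed.

Lemma max_full_classes_ge (r : nat) (C : eqType) (c : T -> C) :
  optimal_coloring r c -> #|full_classes r c| <= max_full_classes r.
Proof.
have [c' E] := recolor c; rewrite /optimal_coloring /full_classes.
rewrite -(same_bounded r E) -(same_classes E) => oc'.
exact: (@leq_bigmax_cond _ (fun c : {ffun T -> T} => optimal_coloring r c)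
  (fun c : {ffun T -> T} => #|full_classes r c|) c' oc').
Qed.

Lemma bounded_chi_attained (r : nat) : irreflexive e -> 0 < r ->
  exists c : {ffun T -> T}, optimal_coloring r c.
Proof.
move=> irr r_gt0; rewrite /optimal_coloring /bounded_chi.
have class1 v : [set u | [ffun x : T => x] u == [ffun x => x] v] = [set v].
  by apply/setP=> u; rewrite !inE !ffunE.
elim/big_ind: _ => [|m n|c bc]; last by exists c; rewrite bc eqxx.
- exists [ffun x => x]; apply/andP; split.
    apply/andP; split.
      apply/'forall_forallP=> u v; apply/implyP; rewrite !ffunE.
      by apply: contraTneq => ->; rewrite irr.
    by apply/forall_inP=> _ /imsetP[v _ ->]; rewrite class1 cards1.
  rewrite card_imset ?cardsT //.
  by move=> u v; rewrite !class1; apply: set1_inj.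
- by rewrite /minn; case: ifP.
Qed.

Lemma max_full_classes_attained (r : nat) : irreflexive e -> 0 < r ->
  exists2 c : {ffun T -> T},
    optimal_coloring r c & #|full_classes r c| = max_full_classes r.
Proof.
move=> irr r_gt0; have [c0 oc0] := bounded_chi_attained irr r_gt0.
have [|c oc maxE] := @eq_bigmax_cond _
  (fun c : {ffun T -> T} => optimal_coloring r c)
  (fun c : {ffun T -> T} => #|full_classes r c|).
  by apply/card_gt0P; exists c0.
by exists c => //; rewrite -maxE.
Qed.

End Graph.

(* Main.v *)
(* Fix an optimal r-bounded coloring with the maximal number of full classes,
   let S be its set of vertices that are alone in their class, and let k be the
   number of classes of size less than r.  If 2|S| <= omega, counting vertices
   class by class gives (2).  Otherwise, if (1) fails, every v in S, having a
   neighbor in each other non-full class, has a single neighbor in at least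
   2k - 2 - Delta >= omega classes; let X_v be the set of these sole neighbors.
   Exchanging the colors of v and of some x in X_v yields another optimal
   coloring, in which x is alone.  As vertices alone in their class are pairwise
   adjacent, X_v is completely joined to S, and x in X_v \ S, y in X_w \ S are
   adjacent or equal for v != w.  Since 2|S| > omega, one can greedily choose
   distinct representatives of omega + 1 - |S| of the sets X_v \ S, and adding
   them to S gives a clique with omega + 1 vertices. *)
Require Import Defs.
From mathcomp Require Import all_boot all_order all_fingroup all_algebra.
From mathcomp Require Import zify lra.

Set Implicit Arguments.
Unset Strict Implicit.
Unset Printing Implicit Defensive.

Import GRing.Theory Num.Theory.

Section LonelyVertices.

Variables (T : finType) (e : rel T).
Hypotheses (e_sym : symmetric e) (e_irr : irreflexive e).

(** * Classes indexed by colors, vertices alone in their class, sole neighbors *)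

Section Coloring.

Variables (C : finType) (c : T -> C).

Definition color_class (a : C) : {set T} := [set u | c u == a].

Lemma color_class_inj : {in codom c &, injective color_class}.
Proof.
move=> _ b /codomP[u ->] _ eq_ab.
have: u \in color_class (c u) by rewrite inE.
by rewrite eq_ab inE => /eqP.
Qed.

Lemma color_classes_imset :
  color_classes c = color_class @: [set a in codom c].
Proof.
apply/setP=> A; apply/imsetP/imsetP=> [[v _ ->]|[a]].
  by exists (c v); rewrite ?inE ?codom_f.
by rewrite inE => /codomP[v ->] ->; exists v.
Qed.

Lemma card_color_classes : #|color_classes c| = #|codom c|.
Proof.
rewrite color_classes_imset card_in_imset ?cardsE // => a b.
by rewrite !inE; apply: color_class_inj.
Qed.

Lemma card_full_classes (r : nat) :
  #|full_classes r c| = #|[set a in codom c | #|color_class a| == r]|.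
Proof.
rewrite -(@card_in_imset _ _ color_class) => [|a b].
  apply: eq_card => A; rewrite !inE color_classes_imset.
  apply/andP/imsetP => [[/imsetP[a]]|[a]].
    by rewrite inE => ca -> /eqP Ar; exists a; rewrite // inE ca Ar /=.
  by rewrite inE => /andP[ca ar] ->; rewrite ar imset_f ?inE.
by rewrite !inE => /andP[ca _] /andP[cb _]; apply: color_class_inj.
Qed.

Lemma bounded_coloringP (r : nat) :
  reflect ((forall u v, e u v -> c u != c v) /\
           (forall a, #|color_class a| <= r))
          (bounded_coloring e r c).
Proof.
apply: (iffP andP) => [[/'forall_forallP pc /forall_inP bc]|[pc bc]]; split.
- by move=> u v; apply/implyP.
- move=> a; have [ca|cNa] := boolP (a \in codom c).
    by apply: bc; rewrite color_classes_imset imset_f ?inE.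
  rewrite (_ : color_class a = set0) ?cards0 //; apply/setP=> u.
  by rewrite !inE; apply: contraNF cNa => /eqP <-; apply: codom_f.
- by apply/'forall_forallP=> u v; apply/implyP/pc.
- by apply/forall_inP=> A; rewrite color_classes_imset => /imsetP[a _ ->].
Qed.

Lemma sum_card_color_class (A : {set T}) (P : pred C) :
  (forall u, u \in A -> P (c u)) ->
  \sum_(a | P a) #|[set u in A | c u == a]| = #|A|.
Proof.
move=> AP; rewrite -[RHS]sum1_card (partition_big c P) //=.
by apply: eq_bigr => a _; rewrite -sum1_card; apply: eq_bigl => u; rewrite inE.
Qed.

Definition lonely : {set T} := [set v | #|color_class (c v)| == 1].

Lemma lonelyP (v u : T) : v \in lonely -> c u = c v -> u = v.
Proof.
rewrite inE => /cards1P[w cE] cuv.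
have: u \in color_class (c v) by rewrite inE cuv.
have: v \in color_class (c v) by rewrite inE.
by rewrite cE !inE => /eqP-> /eqP.
Qed.

(** The set X_v of the overview; full classes count as well, and it may meet [lonely c]. *)
Definition sole_nbrs (v : T) : {set T} :=
  [set x | e v x & [forall y, (e v y && (c y == c x)) ==> (y == x)]].

Lemma sole_nbrsP (v x : T) :
  reflect (e v x /\ forall y, e v y -> c y = c x -> y = x) (x \in sole_nbrs v).
Proof.
rewrite inE; apply: (iffP andP) => -[evx xP]; split=> //.
  by move=> y evy cyx; apply/eqP/(implyP (forallP xP y)); rewrite evy cyx /=.
by apply/forallP=> y; apply/implyP=> /andP[evy /eqP cyx]; apply/eqP/xP.
Qed.

End Coloring.

(** * Recoloring and exchange arguments in an optimal coloring *)

Section Optimal.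

Variables (r : nat) (C : finType).
Implicit Type c : T -> C.

(** Otherwise [v] could move into the class of [w], which has room, and its old color would vanish,
    leaving fewer classes than the optimum. *)
Lemma optimal_lonely_nbr c (v w : T) :
    optimal_coloring e r c -> v \in lonely c -> w != v ->
    #|color_class c (c w)| < r ->
  exists2 u, e v u & c u = c w.
Proof.
case/andP=> /bounded_coloringP[pc bc] /eqP opt v1 wv wr.
have [/existsP[u /andP[evu /eqP cuw]]|/existsPn noU] :=
  boolP [exists u, e v u && (c u == c w)]; first by exists u.
pose c' u := if u == v then c w else c u.
have cwv : c w != c v by apply: contraNneq wv => /(lonelyP v1) ->.
have bc' : bounded_coloring e r c'.
  apply/bounded_coloringP; split=> [x y|a].
    rewrite /c'; case: (x =P v) => [->|_]; case: (y =P v) => [->|_]; rewrite ?e_irr //.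
    - by move=> evy; have := noU y; rewrite evy /= eq_sym.
    - by move=> exv; have := noU x; rewrite e_sym exv.
    exact: pc.
  have [->|aw] := eqVneq a (c w).
    apply: leq_trans wr; apply: leq_trans (_ : #|v |: color_class c (c w)| <= _).
      apply/subset_leq_card/subsetP=> u; rewrite !inE /c'.
      by case: (u == v).
    by rewrite cardsU1; case: (v \notin _).
  apply: leq_trans (bc a); apply/subset_leq_card/subsetP=> u; rewrite !inE /c'.
  by case: (u == v) => //; rewrite eq_sym (negPf aw).
have := bounded_chi_le bc'; rewrite -opt !card_color_classes.
suff: #|codom c'| < #|codom c| by lia.
apply: proper_card; apply/properP; split.
  by apply/subsetP=> _ /codomP[u ->]; rewrite /c'; case: ifP; rewrite codom_f.
exists (c v); rewrite ?codom_f //; apply/codomP=> -[u].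
rewrite /c'; case: eqP => [_ /esym/eqP|uv /esym cuv]; first exact/negP.
by case: uv; apply: lonelyP cuv.
Qed.

(** As [1 < r], the class of a lonely vertex still has room, and that vertex is the only possible
    neighbor in it. *)
Lemma lonely_clique c : 1 < r -> optimal_coloring e r c ->
  {in lonely c &, forall v w, v != w -> e v w}.
Proof.
move=> r_gt1 oc v w v1 w1 vw; have := w1; rewrite inE => /eqP w1E.
have [||u evu] := optimal_lonely_nbr oc v1 (w := w); rewrite ?w1E // 1?eq_sym //.
by move/(lonelyP w1) <-.
Qed.

Lemma card_class_swap c (v x : T) (a : C) :
  #|color_class (c \o tperm v x) a| = #|color_class c a|.
Proof.
rewrite -(card_preimset (color_class c a) (@perm_inj _ (tperm v x))).
by apply: eq_card => u; rewrite !inE.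
Qed.

Lemma lonely_swap c (v x u : T) :
  (u \in lonely (c \o tperm v x)) = (tperm v x u \in lonely c).
Proof. by rewrite !inE card_class_swap. Qed.

(** The only neighbor of [v] in the class that it enters is [x], which leaves it; [x] receives a
    color that no other vertex has. Class sizes are kept. *)
Lemma optimal_swap c (v x : T) :
    optimal_coloring e r c -> v \in lonely c -> x \in sole_nbrs c v ->
  optimal_coloring e r (c \o tperm v x).
Proof.
move=> /andP[/bounded_coloringP[pc bc] opt] v1 /sole_nbrsP[evx xP].
have cv u : u != v -> c u != c v by apply: contraNneq => /(lonelyP v1) ->.
apply/andP; split; last first.
  rewrite -(eqP opt) !card_color_classes; apply/eqP/eq_card => a.
  apply/codomP/codomP=> -[u ->] /=; first by exists (tperm v x u).
  by exists (tperm v x u); rewrite /= tpermK.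
apply/bounded_coloringP; split=> [|a]; last by rewrite card_class_swap.
have key u : e v u -> u != x -> c u != c x.
  by move=> evu; apply: contraNneq => /(xP _ evu) ->.
move=> u w /=; case: tpermP => [->|->|/eqP uv /eqP ux];
  case: tpermP => [->|->|/eqP wv /eqP wx]; rewrite ?e_irr //.
- by move=> _; apply: pc; rewrite e_sym.
- by rewrite eq_sym => evw; apply: key.
- by move=> _; apply: pc.
- by move=> _; rewrite eq_sym cv.
- by rewrite e_sym => euv; apply: key.
- by move=> _; apply: cv.
- exact: pc.
Qed.

Hypothesis r_gt1 : 1 < r.

(** For [w] other than [v], exchanging the colors of [v] and [x] makes [x] lonely and keeps [w]
    lonely. *)
Lemma lonely_adj_sole c (v w x : T) :
    optimal_coloring e r c -> v \in lonely c -> w \in lonely c ->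
    x \in sole_nbrs c v -> x != w -> e w x.
Proof.
move=> oc v1 w1 xv xw; have [evx _] := sole_nbrsP _ _ _ xv.
have [<- //|vw] := eqVneq v w.
apply: (lonely_clique r_gt1 (optimal_swap oc v1 xv)); rewrite 1?eq_sym //.
  by rewrite lonely_swap tpermD.
by rewrite lonely_swap tpermR.
Qed.

(** Two exchanges in a row, [v] with [x] and then [w] with [y], make [x] and [y] both lonely. *)
Lemma sole_nbrs_adj c (v w x y : T) :
    optimal_coloring e r c -> v \in lonely c -> w \in lonely c -> v != w ->
    x \in sole_nbrs c v -> y \in sole_nbrs c w ->
    x \notin lonely c -> y \notin lonely c -> x != y -> e x y.
Proof.
move=> oc v1 w1 vw xv yw x1 y1 xy.
have xw : x != w by apply: contraNneq x1 => ->.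
have yv : y != v by apply: contraNneq y1 => ->.
have ewx := lonely_adj_sole oc v1 w1 xv xw.
have [ewy yP] := sole_nbrsP _ _ _ yw; have [evx _] := sole_nbrsP _ _ _ xv.
have cxy : c x != c y by apply: contraNneq xy => /(yP _ ewx) ->.
have cvy : c v != c y by rewrite eq_sym; apply: contraNneq yv => /(lonelyP v1) ->.
have oc1 := optimal_swap oc v1 xv.
have w11 : w \in lonely (c \o tperm v x) by rewrite lonely_swap tpermD.
(* The first exchange recolors only [v] and [x], and neither gets the color of [y]. *)
have yw1 : y \in sole_nbrs (c \o tperm v x) w.
  apply/sole_nbrsP; split=> //= u ewu; rewrite [in RHS]tpermD // 1?eq_sym //.
  case: tpermP => [_|_|_ _]; last exact: yP.
    by move/eqP; rewrite (negPf cxy).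
  by move/eqP; rewrite (negPf cvy).
have oc2 := optimal_swap oc1 w11 yw1.
apply: (lonely_clique r_gt1 oc2) => //; last by rewrite lonely_swap tpermR.
by rewrite lonely_swap (tpermD (x := w)) 1?eq_sym // lonely_swap tpermR.
Qed.

(** Each non-full class other than that of [v] contains two neighbors of [v], or a single one that
    is counted again as a sole neighbor. The final 2 pays for the class of [v]. *)
Lemma card_sole_nbrs c (v : T) : optimal_coloring e r c -> v \in lonely c ->
  2 * #|[set a in codom c | #|color_class c a| != r]|
    <= #|[set u | e v u]| + #|sole_nbrs c v| + 2.
Proof.
move=> oc v1; have /andP[/bounded_coloringP[_ bc] _] := oc.
set D := [set a in _ | _]; rewrite (cardsD1 (c v) D).
rewrite -(@sum_card_color_class _ c [set u | e v u] predT) //.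
rewrite -(@sum_card_color_class _ c (sole_nbrs c v) predT) // -big_split /=.
suff: 2 * #|D :\ c v| <= \sum_(a in D :\ c v)
    (#|[set u in [set u | e v u] | c u == a]| +
     #|[set u in sole_nbrs c v | c u == a]|).
  move=> le_D; rewrite (bigID [in D :\ c v]) /=.
  by move: le_D (leq_b1 (c v \in D)); lia.
rewrite mulnC -sum_nat_const; apply: leq_sum => a.
rewrite !inE => /and3P[av /codomP[w aE] ar].
have wv : w != v by apply: contraNneq av => <-; rewrite aE.
have [|u evu cu] := optimal_lonely_nbr oc v1 wv.
  by rewrite ltn_neqAle bc -aE ar.
set N := [set _ in _ | _]; set N1 := [set _ in _ | _].
have uN : u \in N by rewrite !inE evu cu aE /=.
have [N1_gt0|] := posnP #|N1|; last first.
  by have: 0 < #|N| by [apply/card_gt0P; exists u]; lia.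
suff: 1 < #|N| by lia.
rewrite ltnNge; apply/negP => N_le1.
suff: u \in N1 by rewrite (cards0_eq N1_gt0) inE.
rewrite inE cu aE eqxx andbT; apply/sole_nbrsP; split=> // y evy cy.
by apply: (card_le1_eqP N_le1) => //; rewrite !inE evy cy cu aE /=.
Qed.

Lemma lonely_clique_extension c (m n : nat) :
    optimal_coloring e r c -> n <= #|lonely c| -> n <= m ->
    {in lonely c, forall v, m <= #|sole_nbrs c v :\: lonely c|} ->
  exists2 K : {set T}, clique e K & #|K| = #|lonely c| + n.
Proof.
move=> oc n_le n_lem mP.
(* [Y] collects the representatives and [V] the lonely vertices they come from. Taking each new [v]
   outside [V] gives the distinctness that [sole_nbrs_adj] requires. *)
suff [V [Y [_ YL nY [_ Y_clique]]]] :
    exists V Y : {set T},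
    [/\ V \subset lonely c /\ #|V| = n, [disjoint lonely c & Y], #|Y| = n
      & {in Y, forall y, exists2 v, v \in V & y \in sole_nbrs c v}
        /\ clique e (lonely c :|: Y)].
  by exists (lonely c :|: Y); rewrite // cardsU disjoint_setI0 // cards0 subn0 nY.
elim: n n_le n_lem => [|n IHn] n_le n_lem.
  exists set0, set0; split; rewrite ?sub0set ?cards0 //.
    by rewrite -setI_eq0 setI0.
  split=> [y|]; rewrite ?inE // setU0.
  apply/forall_inP=> u u1; apply/forall_inP=> w w1; apply/implyP.
  exact: (lonely_clique r_gt1 oc).
have [V [Y [[VL nV] YL nY [YE Y_clique]]]] := IHn (ltnW n_le) (ltnW n_lem).
have /subsetPn[v v1 vV] : ~~ (lonely c \subset V).
  by apply/negP=> /subset_leq_card; lia.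
(* [Y] has only [n < m] elements, so it cannot contain all the candidates. *)
have /subsetPn[x] : ~~ (sole_nbrs c v :\: lonely c \subset Y).
  by apply/negP=> /subset_leq_card; have := mP v v1; lia.
rewrite in_setD => /andP[x1 xv] xY.
have adj u : u \in lonely c :|: Y -> e x u.
  rewrite in_setU => /orP[u1|uY].
    by rewrite e_sym (lonely_adj_sole oc v1 u1 xv) //; apply: contraNneq x1 => ->.
  have [w wV uw] := YE u uY; have w1 := subsetP VL w wV.
  apply: (sole_nbrs_adj oc v1 w1 _ xv uw x1).
  - by apply: contraNneq vV => ->.
  - by rewrite (disjointFl YL uY).
  - by apply: contraNneq xY => ->.
exists (v |: V), (x |: Y); split.
- by rewrite subUset sub1set v1 cardsU1 vV nV.
- rewrite disjoint_sym -setI_eq0 setIUl setU_eq0 !setI_eq0 disjoints1 x1.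
  by rewrite disjoint_sym.
- by rewrite cardsU1 xY nY.
split.
  move=> y /setU1P[->|yY]; first by exists v; rewrite ?setU11.
  by have [w wV yw] := YE y yY; exists w; rewrite // setU1r.
rewrite setUCA; apply/forall_inP=> u uP; apply/forall_inP=> w wP.
apply/implyP => uw; case/setU1P: uP wP uw => [->|uP] /setU1P[->|wP].
- by rewrite eqxx.
- by move=> _; apply: adj.
- by move=> _; rewrite e_sym; apply: adj.
by apply/implyP; move/forall_inP/(_ u uP)/forall_inP: Y_clique; apply.
Qed.

Lemma lonely_nonfull_bound c : optimal_coloring e r c ->
    clique_number e < 2 * #|lonely c| ->
  2 * #|[set a in codom c | #|color_class c a| != r]|
    <= clique_number e + max_degree e + 1.
Proof.
move=> oc; set w := clique_number e; set D := [set a in _ | _] => ltw.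
rewrite leqNgt; apply/negP=> D_gt.
have clique_le K : clique e K -> #|K| <= w.
  by move=> Kc; apply: (@leq_bigmax_cond _ (clique e) (fun K : {set T} => #|K|)).
have le_sw : #|lonely c| <= w.
  apply: clique_le; apply/forall_inP=> u u1; apply/forall_inP=> v v1.
  by apply/implyP; apply: (lonely_clique r_gt1 oc).
(* This size gives a clique with [w.+1] vertices; enough lonely vertices are available because
   [w < 2 * #|lonely c|]. *)
have [|||K /clique_le] :=
    @lonely_clique_extension c (w.+1 - #|lonely c|) (w.+1 - #|lonely c|) oc.
- lia.
- by [].
- move=> v v1; have := card_sole_nbrs oc v1; rewrite -/D.
  have : #|[set u | e v u]| <= max_degree e.
    exact: (@leq_bigmax T (fun v => #|[set u | e v u]|)).
  have := cardsID (lonely c) (sole_nbrs c v).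
  (* Strict, since [v] is lonely but not its own neighbor; the bound needs this extra 1. *)
  have : #|sole_nbrs c v :&: lonely c| < #|lonely c|.
    apply: proper_card; apply/properP; split; first exact: subsetIr.
    by exists v; rewrite // !inE e_irr.
  lia.
by move=> le_Kw; lia.
Qed.

End Optimal.

(** A non-full used class contributes at least 2 on the right: a singleton counts once as a vertex
    and once as a lonely vertex. *)
Lemma card_nonfull_lonely (r : nat) (C : finType) (c : T -> C) :
  r * #|[set a in codom c | #|color_class c a| == r]|
    + 2 * #|[set a in codom c | #|color_class c a| != r]|
  <= #|T| + #|lonely c|.
Proof.
rewrite -cardsT -(@sum_card_color_class _ c setT predT) //.
rewrite -(@sum_card_color_class _ c (lonely c) predT) // -big_split /=.
rewrite (bigID [in codom c]) /=; apply: leq_trans (leq_addr _ _).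
rewrite (bigID (fun a => #|color_class c a| == r)) /=.
rewrite mulnC [2 * _]mulnC -!sum_nat_const; apply: leq_add.
  rewrite (eq_bigl (fun a => (a \in codom c) && (#|color_class c a| == r))).
    apply: leq_sum => a /andP[_ /eqP {1}<-]; apply: leq_trans (leq_addr _ _).
    by apply/subset_leq_card/subsetP=> u; rewrite !inE.
  by move=> a; rewrite inE.
rewrite (eq_bigl (fun a => (a \in codom c) && (#|color_class c a| != r))).
  2: by move=> a; rewrite inE.
apply: leq_sum => a /andP[/codomP[u aE] _].
have -> : [set v in [set: T] | c v == a] = color_class c a.
  by apply/setP=> v; rewrite !inE.
have a_gt0 : 0 < #|color_class c a|.
  by apply/card_gt0P; exists u; rewrite inE aE.
have [a1|] := eqVneq #|color_class c a| 1; last by lia.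
have: 0 < #|[set v in lonely c | c v == a]| by
  apply/card_gt0P; exists u; rewrite !inE -aE a1 !eqxx.
lia.
Qed.

End LonelyVertices.

(** * The two alternatives, in rational arithmetic *)

Local Open Scope ring_scope.

Theorem theorem6p14 (T : finType) (e : rel T) (e_sym : symmetric e)
    (e_irr : irreflexive e) (r : nat) (r_ge1 : (1 <= r)%N) :
  ((bounded_chi e r)%:R - (max_full_classes e r)%:R : rat)
     <= ((clique_number e)%:R + (max_degree e)%:R + 1) / 2
  \/
  ((bounded_chi e r)%:R - (max_full_classes e r)%:R : rat)
     <= ((clique_number e)%:R / 2 + #|T|%:R
         - r%:R * (max_full_classes e r)%:R) / 2.
Proof.
have [c oc fullE] := max_full_classes_attained e_irr r_ge1.
have /andP[/bounded_coloringP[_ bc] /eqP chiE] := oc.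
have countT := card_nonfull_lonely r c.
have bound := lonely_nonfull_bound e_sym e_irr _ oc.
rewrite -fullE -chiE card_color_classes card_full_classes.
set M := [set a in _ | _] in countT *; set D := [set a in _ | _] in countT bound.
have -> : #|codom c| = (#|M| + #|D|)%N.
  rewrite -[LHS]cardsE -(cardsID [set a | #|color_class c a| == r]).
  by congr addn; apply: eq_card => a; rewrite !inE // andbC.
rewrite natrD addrAC subrr add0r.
(* The left side is now [#|D|], the number of non-full classes. For [r = 1] every used class is
   full, so it is 0. *)
have [r_gt1|r_le1] := ltnP 1 r; last first.
  left; rewrite (_ : #|D| = 0%N) ?divr_ge0 ?addr_ge0 //.
  apply: eq_card0 => a; rewrite !inE; apply/andP=> -[/codomP[u aE]].
  have: (0 < #|color_class c a|)%N by apply/card_gt0P; exists u; rewrite inE aE.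
  by have := bc a; lia.
have [le_s|lt_s] := leqP (2 * #|lonely c|) (clique_number e); [right|left].
  (* This is (2) multiplied by 4, which clears the nested halves. *)
  have le4 : (2 * (r * #|M|) + 4 * #|D| <= 2 * #|T| + clique_number e)%N by lia.
  by move: le4; rewrite -(ler_nat rat) !natrD !natrM; lra.
move: (bound r_gt1 lt_s); rewrite -(ler_nat rat) natrM !natrD; lra.
Qed.
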